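(* Let $\alpha$ be a countable ordinal and let $X_1$, $X_2$ be uncountable metrizable compact spaces such that the following conditions are satisfied for each $i \in \{1,2\}$: (a) $\mathrm{CB}(x,X_i) < \alpha$ for every $x \in X_i \setminus \mathrm{PK}(X_i)$; (b) $\mathrm{PK}(X_i) \subseteq \overline{\{ x \in X_i \setminus \mathrm{PK}(X_i) : \mathrm{CB}(x,X_i) = \beta \}}$ for every $\beta < \alpha$. Then every homeomorphism $h \colon \mathrm{PK}(X_1) \to \mathrm{PK}(X_2)$ extends to a homeomorphism $\overline{h} \colon X_1 \to X_2$.
   Context: A subset of a topological space is perfect if it is closed and has no isolated points. For a Polish space $X$, the perfect kernel $\mathrm{PK}(X)$ is the unique perfect set $P \subseteq X$ such that $X \setminus P$ is countable; equivalently, $X \setminus \mathrm{PK}(X)$ is the set of all points of $X$ having a countable neighbourhood. For a compact metrizable space $X$, the Cantor-Bendixson derivatives are $X^{(0)}=X$, $X^{(\beta+1)}=(X^{(\beta)})'$ (the set of limit points of $X^{(\beta)}$), and $X^{(\lambda)}=\bigcap_{\gamma<\lambda}X^{(\gamma)}$ for limit $\lambda$. If $X$ is countable compact metrizable, $\mathrm{CB}(X)$ is the least ordinal $\alpha$ with $X^{(\alpha+1)}=\emptyset$. For compact metrizable $X$ and $x \in X \setminus \mathrm{PK}(X)$, $\mathrm{CB}(x,X) := \min\{\mathrm{CB}(K) : K \subseteq X \text{ is a countable compact neighbourhood of } x\}$; equivalently, it is the least ordinal $\alpha$ with $x \notin X^{(\alpha+1)}$. *)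

(* Defs.v *)
From HB Require Import structures.
From mathcomp Require Import all_boot all_order all_algebra.
From mathcomp Require Import all_classical all_reals all_analysis.

Set Implicit Arguments.
Unset Strict Implicit.
Unset Printing Implicit Defensive.

Import Order.TTheory.
Local Open Scope classical_set_scope.

(* An ordinal alpha is given by a well-ordered type, whose elements stand, as  *)
(* for von Neumann ordinals, for the ordinals beta < alpha.  The type may be   *)
(* empty (alpha = 0).  Any such type of order type alpha can be used.          *)
HB.mixin Record Total_isWellOrder (d : Order.disp_t) T & Order.Total d T := {
  lt_wf : well_founded (fun b c : T => (b < c)%O)
}.

#[short(type="wellOrderType")]
HB.structure Definition WellOrder (d : Order.disp_t) :=
  { T of Order.Total d T & Total_isWellOrder d T }.

Section CantorBendixson.
Context {d : Order.disp_t} {alpha : wellOrderType d} {T : topologicalType}.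
Implicit Types (b c e : alpha) (K : set T) (x : T).

Definition ord_zero b := forall c, (b <= c)%O.

(* b = c + 1 *)
Definition ord_succ c b := (c < b)%O /\ forall e, (e < b)%O -> (e <= c)%O.

Definition ord_limit b := ~ ord_zero b /\ forall c, ~ ord_succ c b.

(* Exactly one of the three premises holds for a given b, so this conjunction  *)
(* is a definition by cases.                                                   *)
Definition CB_step K b (D : forall c, (c < b)%O -> set T) : set T :=
  [set x | [/\ ord_zero b -> K x,
    forall c (cb : (c < b)%O), ord_succ c b -> limit_point (D c cb) x &
    ord_limit b -> forall c (cb : (c < b)%O), D c cb x]].

(* The derivative K^(b) of the subspace K.  Limit points are taken in the      *)
(* ambient space T; for K closed in a Hausdorff space, every K^(b) is closed,  *)
(* so these are the limit points in K, and in K^(b) itself.                    *)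
Definition CB_derivative K : alpha -> set T :=
  Fix (@lt_wf d alpha) (fun=> set T) (CB_step K).

Lemma CB_derivativeE K b :
  CB_derivative K b = CB_step K (fun c (_ : (c < b)%O) => CB_derivative K c).
Proof.
rewrite /CB_derivative Fix_eq// => {}b D D' DD'.
by congr CB_step; apply: functional_extensionality_dep => c; apply: funext.
Qed.

Lemma CB_derivative_zero K b : ord_zero b -> CB_derivative K b = K.
Proof.
move=> b0; rewrite CB_derivativeE; apply/seteqP; split=> [x [Kx _ _]|x Kx].
  exact: Kx.
split=> // [c cb|[]//]; exfalso; by move: (lt_le_trans cb (b0 c)); rewrite ltxx.
Qed.

Lemma CB_derivative_succ K c b : ord_succ c b ->
  CB_derivative K b = limit_point (CB_derivative K c).
Proof.
move=> cb; rewrite CB_derivativeE; apply/seteqP; split=> [x [_ + _]|x Dx].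
  by move=> /(_ c cb.1 cb).
split=> [b0|e eb [_ be]|[_ /(_ c)]//].
  by move: (lt_le_trans cb.1 (b0 c)); rewrite ltxx.
have -> // : e = c.
by apply/le_anti/andP; split; [exact: cb.2 | exact: be cb.1].
Qed.

Lemma CB_derivative_limit K b : ord_limit b ->
  CB_derivative K b = \bigcap_(c in [set c | (c < b)%O]) CB_derivative K c.
Proof.
move=> bl; rewrite CB_derivativeE; apply/seteqP; split=> [x [_ _ Dx] c cb|x Dx].
  exact: Dx.
by split=> [b0|c cb /(bl.2 c)|_]//; case: bl => /(_ b0).
Qed.

(* CB(K) = b.  Here K^(b+1) is written (K^(b))', because b + 1 need not be an  *)
(* element of alpha.                                                           *)
Definition CB_rank_eq K b :=
  limit_point (CB_derivative K b) = set0 /\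
  forall c, limit_point (CB_derivative K c) = set0 -> (b <= c)%O.

Definition countable_compact_nbhs x K := [/\ nbhs x K, countable K & compact K].

(* CB(x, T) = b.  Since elements of alpha represent the ordinals below alpha,  *)
(* CB(x, T) < alpha is expressed as exists b : alpha, CB_point_eq x b.         *)
Definition CB_point_eq x b :=
  (exists2 K, countable_compact_nbhs x K & CB_rank_eq K b) /\
  forall K c, countable_compact_nbhs x K -> CB_rank_eq K c -> (b <= c)%O.

End CantorBendixson.

(* get selects the unique set with the property; existence and uniqueness are  *)
(* the Cantor-Bendixson theorem for Polish spaces.                             *)
Definition perfect_kernel (T : topologicalType) : set T :=
  get [set P : set T | perfect_set P /\ countable (~` P)].
Arguments perfect_kernel : clear implicits.

(* f restricts to a homeomorphism from the subspace A onto the subspace B; the *)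
(* values of f outside A are irrelevant.                                       *)
Definition homeomorphism (T U : topologicalType) (A : set T) (B : set U)
    (f : T -> U) :=
  [/\ set_bij A B f, {within A, continuous f} &
    exists2 g : U -> T, (forall x, A x -> g (f x) = x) &
      {within B, continuous g}].

(* Main.v *)
(** The proof is a back-and-forth argument. The complement U_i of PK(X_i) is
    countable and open, and each of its points x has a basis of clopen
    neighbourhoods in which x is the unique point of maximal rank ("peaks").
    Assume that peaks of equal rank are homeomorphic. Then one enumerates both U_1
    and U_2 and repeatedly matches a small peak around the next uncovered point x
    with a small peak of the same rank on the other side: if p is an (almost)
    nearest point of PK(X_1) to x, the partner is chosen close to h(p), which
    condition (b) allows. By compactness all but finitely many of the matched
    pieces are close to the kernels, so the union of h and of the homeomorphisms
    between pieces is continuous.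

    Peaks of rank b at x and y are homeomorphic by well-founded induction on b, by
    the same extension argument: it extends the map {x} -> {y}, because every
    rank c < b accumulates at x and at y. *)

Require Import Defs.
From HB Require Import structures.
From mathcomp Require Import all_boot all_order all_algebra.
From mathcomp Require Import all_classical all_reals all_analysis.
From mathcomp Require Import lra.

Set Implicit Arguments.
Unset Strict Implicit.
Unset Printing Implicit Defensive.

Import Order.TTheory GRing.Theory Num.Theory.
Local Open Scope classical_set_scope.

(** * Elements of a well-order: zero, successors and limits *)

Section WellOrder.
Context {d : Order.disp_t} {alpha : wellOrderType d}.
Implicit Types b c e : alpha.

Lemma wo_min (S : set alpha) b : S b ->
  exists2 m, S m & forall c, S c -> (m <= c)%O.
Proof.
elim: (lt_wf b) => {}b _ IH Sb.
have [[c [Sc cb]]|nS] := EM (exists c, S c /\ (c < b)%O); first exact: IH cb Sc.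
exists b => // c Sc; rewrite leNgt; apply/negP => cb.
by apply: nS; exists c.
Qed.

Lemma ord_trichotomy b :
  [\/ ord_zero b, exists c, ord_succ c b | ord_limit b].
Proof.
have [b0|b0] := EM (ord_zero b); first exact: Or31.
have [bS|bS] := EM (exists c, ord_succ c b); first exact: Or32.
by apply: Or33; split=> // c bc; apply: bS; exists c.
Qed.

Lemma ord_limit_between c b : ord_limit b -> (c < b)%O ->
  exists2 e, (c < e)%O & (e < b)%O.
Proof.
move=> [_ /(_ c) ncb] cb; apply/not_exists2P => nce; apply: ncb; split=> // e eb.
by rewrite leNgt; apply/negP => ce; case: (nce e).
Qed.

End WellOrder.

(** * Cantor-Bendixson derivatives and the rank of a point *)

Section CBDerivative.
Context {d : Order.disp_t} {alpha : wellOrderType d} {T : topologicalType}.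
Hypothesis T2 : hausdorff_space T.
Implicit Types (b c e : alpha) (K L O : set T) (x : T).

Lemma limit_pointS K L : K `<=` L -> limit_point K `<=` limit_point L.
Proof. by move=> KL x Kx U /Kx[y [yx /KL]]; exists y. Qed.

Lemma closed_limit_point_sub K : closed K -> limit_point K `<=` K.
Proof. by move=> cK x /subset_limit_point/cK. Qed.

Lemma CB_derivative_closed K b : closed K -> closed (CB_derivative K b).
Proof.
move=> cK; elim: (lt_wf b) => {}b _ IH; have [b0|[c cb]|bl] := ord_trichotomy b.
- by rewrite CB_derivative_zero.
- rewrite (CB_derivative_succ _ cb); apply: limit_point_closed.
  exact: hausdorff_accessible.
- by rewrite (CB_derivative_limit _ bl); apply: closed_bigI => c cb; exact: IH.
Qed.

Lemma CB_derivative_le K b c : closed K -> (b <= c)%O ->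
  CB_derivative K c `<=` CB_derivative K b.
Proof.
move=> cK; elim: (lt_wf c) => {}c _ IH.
rewrite le_eqVlt => /predU1P[->//|bc]; have [c0|[e ec]|cl] := ord_trichotomy c.
- by move: (c0 b); rewrite leNgt bc.
- rewrite (CB_derivative_succ _ ec).
  apply: (subset_trans (closed_limit_point_sub (CB_derivative_closed cK))).
  by apply: (IH e ec.1); exact: ec.2.
- by rewrite (CB_derivative_limit _ cl) => x; apply.
Qed.

Lemma CB_derivative_sub K b : closed K -> CB_derivative K b `<=` K.
Proof.
move=> cK; have [m _ m0] := @wo_min _ alpha setT b I.
have zm : ord_zero m by move=> c; exact: m0.
rewrite -[X in _ `<=` X](CB_derivative_zero K zm).
exact: CB_derivative_le (m0 _ I).
Qed.

Lemma CB_derivative_lt K b c : closed K -> (b < c)%O ->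
  CB_derivative K c `<=` limit_point (CB_derivative K b).
Proof.
move=> cK; elim: (lt_wf c) => {}c _ IH bc.
have [c0|[e ec]|cl] := ord_trichotomy c.
- by move: (c0 b); rewrite leNgt bc.
- rewrite (CB_derivative_succ _ ec); apply: limit_pointS.
  by apply: CB_derivative_le => //; exact: ec.2.
- have [e be ec] := ord_limit_between cl bc.
  by rewrite (CB_derivative_limit _ cl) => x /(_ e ec); exact: IH.
Qed.

(** Whether a point is a limit point depends only on arbitrarily small neighbourhoods, so the
    inclusion on [O] passes through every stage. With [O = setT] this is monotonicity; otherwise it
    compares the derivatives of two neighbourhoods of a point. *)
Lemma CB_derivative_local K L O b : open O -> O `&` K `<=` L ->
  O `&` CB_derivative K b `<=` CB_derivative L b.
Proof.
move=> oO OKL; elim: (lt_wf b) => {}b _ IH.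
have [b0|[c cb]|bl] := ord_trichotomy b.
- by rewrite !CB_derivative_zero.
- rewrite !(CB_derivative_succ _ cb) => x [Ox Kx] U xU.
  have [y [yx Dy [Oy Uy]]] := Kx _ (filterI (open_nbhs_nbhs (conj oO Ox)) xU).
  by exists y; split=> //; apply: (IH c cb.1).
- rewrite !(CB_derivative_limit _ bl) => x [Ox Kx] c cb.
  by apply: (IH c cb); split=> //; exact: Kx.
Qed.

(** The derivatives are closed and decreasing, so by compactness they cannot first become empty at a
    limit stage. This is what bounds the rank of [K] strictly below [b]. *)
Lemma CB_derivative_empty K b : compact K -> K !=set0 ->
  CB_derivative K b = set0 ->
  exists2 c, (c < b)%O & limit_point (CB_derivative K c) = set0.
Proof.
move=> coK K0; have cK := compact_closed T2 coK.
have [b0|[c cb]|bl] := ord_trichotomy b.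
- by rewrite CB_derivative_zero// => KE; move: K0; rewrite KE => -[].
- by rewrite (CB_derivative_succ _ cb) => ?; exists c => //; exact: cb.1.
rewrite (CB_derivative_limit _ bl) => D0.
have [c0 c0b] : exists c0, (c0 < b)%O.
  apply: contrapT => /forallNP nb; case: bl => + _; apply => c.
  by rewrite leNgt; apply/negP/nb.
(* [F] is the filter of tails of the ordinals below [b]; compactness in its near-covering form then
   gives one [c < b] whose derivative is already empty. *)
pose F := filter_from [set c | (c < b)%O] (fun c => [set e | (c <= e < b)%O]).
have FF : ProperFilter F.
  apply: filter_from_proper; last by move=> c cb; exists c; rewrite /= lexx.
  apply: filter_from_filter; first by exists c0.
  move=> c e cb eb; have [ce|ec] := leP c e.
    exists e => // f /= /andP[ef fb]; rewrite ef fb (le_trans ce ef)//.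
  by exists c => // f /= /andP[cf fb]; rewrite cf fb (le_trans (ltW ec) cf).
have := (compact_near_coveringP K).1 coK alpha F
  (fun c x => ~ CB_derivative K c x) _.
move=> /(_ _)[x Kx|c cb Hc].
  have [c [cb nDx]] : exists c, (c < b)%O /\ ~ CB_derivative K c x.
    apply: contrapT => /forallNP nc.
    suff : (\bigcap_(c in [set c | (c < b)%O]) CB_derivative K c) x by rewrite D0.
    by move=> c cb; apply: contrapT => nD; apply: (nc c).
  exists (~` CB_derivative K c, [set e | (c <= e < b)%O]) => /=.
    split; last by exists c.
    apply: open_nbhs_nbhs; split=> //; apply: closed_openC.
    exact: CB_derivative_closed.
  move=> [y e] /= [nDy /andP[ce _]] Dey; apply: nDy.
  exact: CB_derivative_le Dey.
exists c => //; rewrite -subset0 => x.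
move=> /(closed_limit_point_sub (CB_derivative_closed cK)) Dx.
have Kx := CB_derivative_sub cK Dx.
by have /(_ _ x Kx) := Hc c; apply=> //=; rewrite lexx.
Qed.

Hypothesis T3 : @regular_space T.

(** Passes from the minimum over neighbourhoods to a description valid in every countable compact
    neighbourhood. If [x] were not in [K0^(b)], a smaller closed neighbourhood of [x] avoiding that
    closed set would have rank below [b], against minimality. *)
Lemma CB_point_derivative x b K :
  CB_point_eq x b -> nbhs x K -> countable K -> compact K ->
  CB_derivative K b x /\ ~ limit_point (CB_derivative K b) x.
Proof.
move=> [[K0 [xK0 cK0 coK0] [D0 _]] bmin] xK cK coK.
have Dx : CB_derivative K0 b x.
  apply: contrapT => nDx.
  have cD : closed (CB_derivative K0 b).
    by apply: CB_derivative_closed; exact: compact_closed.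
  have xN : nbhs x (K0 `&` ~` CB_derivative K0 b).
    apply: filterI => //; apply: open_nbhs_nbhs; split => //.
    exact: closed_openC.
  have [V xV VK] := T3 xN.
  have coV : compact (closure V).
    apply: subclosed_compact coK0 _; first exact: closed_closure.
    by move=> y /VK[].
  have xV' : nbhs x (closure V) by apply: filterS xV; exact: subset_closure.
  have DV : CB_derivative (closure V) b = set0.
    rewrite -subset0 => y Dy.
    have Vy := CB_derivative_sub (@closed_closure _ V) Dy.
    have [_] := VK _ Vy; apply.
    apply: (@CB_derivative_local (closure V) K0 setT); first exact: openT.
      by move=> z [_ /VK[]].
    by split.
  have [|c cb Dc] := CB_derivative_empty coV _ DV.
    by exists x; exact: nbhs_singleton.
  have [m /= Dm m0] := @wo_min _ alpha
    [set c | limit_point (CB_derivative (closure V) c) = set0] c Dc.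
  have : (b <= m)%O.
    apply: (bmin (closure V)) => //; split => //.
    by apply: sub_countable cK0; apply: subset_card_le => y /VK[].
  by rewrite leNgt (le_lt_trans (m0 _ Dc) cb).
(* On the common interior [O] the derivatives of [K] and [K0] coincide, by locality. *)
pose O := (K `&` K0)°.
have oO : open O by exact: open_interior.
have Ox : O x by apply: filterI.
have OK : O `<=` K `&` K0 by exact: interior_subset.
split.
  apply: (@CB_derivative_local K0 K O) => //.
  by move=> y [/OK[]].
move=> Kx; suff : limit_point (CB_derivative K0 b) x by rewrite D0.
move=> U xU; have [y [yx Dy [Oy Uy]]] :=
  Kx _ (filterI (open_nbhs_nbhs (conj oO Ox)) xU).
exists y; split => //; apply: (@CB_derivative_local K K0 O) => //.
by move=> z [/OK[]].
Qed.

Lemma CB_point_eq_inj x b c : CB_point_eq x b -> CB_point_eq x c -> b = c.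
Proof.
move=> [[K xK Kb] bmin] [[L xL Lc] cmin]; apply/le_anti.
by rewrite (bmin L)// (cmin K).
Qed.

Lemma CB_derivative_rank x b c K :
  CB_point_eq x b -> nbhs x K -> countable K -> compact K ->
  CB_derivative K c x <-> (c <= b)%O.
Proof.
move=> xb xK cK coK; have [Dx nDx] := CB_point_derivative xb xK cK coK.
have clK := compact_closed T2 coK; split => [Dc|cb].
  by rewrite leNgt; apply/negP => bc; apply/nDx/(CB_derivative_lt _ bc).
exact: CB_derivative_le Dx.
Qed.

End CBDerivative.

(** * Clopen neighbourhoods off a set with countable complement *)

Section MetricClopen.
Context {R : realType} {X : metricType R}.
Local Open Scope ring_scope.
Implicit Types (x : X) (A O P : set X).

Lemma nbhs_mdist x (e : R) : 0 < e -> nbhs x [set y | mdist x y < e].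
Proof. by move=> e0; rewrite -ballEmdist; exact: nbhsx_ballx. Qed.

Lemma open_mdist_lt x (e : R) : open [set y | mdist x y < e].
Proof.
rewrite openE => y /= xy; have e0 : 0 < e - mdist x y by rewrite subr_gt0.
apply: filterS (nbhs_mdist y e0) => z /= yz.
by have := metric_triangle x y z; lra.
Qed.

Lemma open_mdist_gt x (e : R) : open [set y | e < mdist x y].
Proof.
rewrite openE => y /= xy; have e0 : 0 < mdist x y - e by rewrite subr_gt0.
apply: filterS (nbhs_mdist y e0) => z /= yz.
by have := metric_triangle x z y; rewrite (metric_sym z y); lra.
Qed.

Lemma clopen_nbhs P x O : countable (~` P) -> ~ P x -> nbhs x (O `\` P) ->
  exists A, [/\ open A, closed A, A x & A `<=` O `\` P].
Proof.
move=> cP Px /nbhs_ballP[e /= e0 xe].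
have cD : countable (mdist x @` ~` P).
  exact: sub_countable (card_image_le _ _) cP.
(* A sphere around x of radius outside a countable set of distances is empty. *)
have [r /andP[r0 re] rD] : exists2 r : R, 0 < r < e & ~ (mdist x @` ~` P) r.
  apply: contrapT => nr.
  (* Otherwise the interval would be countable, hence of Lebesgue measure zero. *)
  have sD : `]0, e[%classic `<=` mdist x @` ~` P.
    move=> r; rewrite /= in_itv/= => r0e; apply: contrapT => rD.
    by apply: nr; exists r.
  have c0 : countable (`]0, e[%classic : set R).
    by apply: sub_countable cD; exact: subset_card_le.
  have := countable_lebesgue_measure0 c0.
  rewrite lebesgue_measure_itv/= lte_fin e0 oppr0 adde0 => -[].
  by move/eqP; rewrite gt_eqF.
exists [set y | mdist x y < r]; split => /=.
- exact: open_mdist_lt.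
- have -> : [set y | mdist x y < r] = ~` [set y | r < mdist x y].
    apply/seteqP; split => y /=; first by move=> ?; apply/negP; rewrite -leNgt ltW.
    move=> /negP; rewrite -leNgt le_eqVlt => /predU1P[xyr|//].
    have [Py|nPy] := EM (P y); last by case: rD; exists y.
    have [] : (O `\` P) y; last by [].
    by apply: xe; rewrite ballEmdist/= xyr.
  by apply: open_closedC; exact: open_mdist_gt.
- by rewrite mdistxx.
- by move=> y /= yr; apply: xe; rewrite ballEmdist/=; lra.
Qed.

End MetricClopen.

(** * Peaks and the accumulation of smaller ranks *)

Section Peaks.
Context {d : Order.disp_t} {alpha : wellOrderType d}.

(** The rank of [x] itself is not recorded here; [CB_point_eq x b] is stated separately. *)
Definition peak (T : topologicalType) (P : set T) (x : T) (b : alpha)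
    (A : set T) :=
  [/\ open A, closed A, A x, A `<=` ~` P &
      forall y, A y -> y != x -> exists2 c, (c < b)%O & CB_point_eq y c].

Context {R : realType} {X : metricType R}.
Variable P : set X.
Hypotheses (clP : closed P) (cP : countable (~` P)).
Hypothesis ranked : forall x, ~ P x -> exists b : alpha, CB_point_eq x b.
Implicit Types (x y : X) (b c : alpha) (O : set X).

Let T2 : hausdorff_space X := @metric_hausdorff _ X.
Let T3 : @regular_space X := @uniform_regular X.

(** Since [x] is not a limit point of [K^(b)], some neighbourhood contains no other point of
    [K^(b)], that is, no other point of rank at least [b]. A clopen set inside it is a peak. *)
Lemma peak_nbhs x b O : ~ P x -> CB_point_eq x b -> nbhs x O ->
  exists2 A, peak P x b A & A `<=` O.
Proof.
move=> Px xb xO; have [[K [xK cK coK] _] _] := xb.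
have [_] := CB_point_derivative T2 T3 xb xK cK coK.
rewrite not_limit_pointE => -[V xV DV].
have xN : nbhs x ((O `&` (V `&` K°)) `\` P).
  apply: filterI; last by apply: open_nbhs_nbhs; split=> //; exact: closed_openC.
  apply: filterI => //; apply: filterI => //.
  by apply: open_nbhs_nbhs; split=> //; exact: open_interior.
have [A [oA cA Ax AN]] := clopen_nbhs cP Px xN.
exists A; last by move=> y /AN[[]].
split=> // [y /AN[]//|y /AN[[_ [Vy Ky]] Py] yx].
have [c yc] := ranked Py; exists c => //.
rewrite ltNge; apply/negP => bc; move/eqP: yx; apply; apply: DV; split=> //.
by apply/(CB_derivative_rank T2 T3 _ yc).
Qed.

(** Plays at a single point of rank [b] the part that condition (b) plays at the kernel. *)
Lemma rank_below_dense x b c O : ~ P x -> CB_point_eq x b -> (c < b)%O ->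
  nbhs x O -> exists y, [/\ O y, ~ P y & CB_point_eq y c].
Proof.
move=> Px xb cb xO; have [[K [xK cK coK] _] _] := xb.
have clK := compact_closed T2 coK.
pose W := (O `&` K)° `\` P.
have oW : open W.
  by apply: openI; [exact: open_interior|exact: closed_openC].
have Wx : W x by split=> //; apply: filterI.
(* All points of [W] have [K] as a neighbourhood, so their ranks are read off the derivatives of
   this one set. *)
have WN y : W y -> [/\ O y, nbhs y K & ~ P y].
  move=> [yOK Py]; split=> //; first by have [] := nbhs_singleton yOK.
  by apply: filterS yOK => z [].
(* The least rank e >= c attained in W is c: a point of rank e > c would be a
   limit of points of rank at least c, and those in a peak around it have rank
   below e. *)
have [e /= [[y [Wy ye]] ce] emin] := @wo_min _ alpha
  [set e | (exists y, W y /\ CB_point_eq y e) /\ (c <= e)%O] b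
  (conj (ex_intro _ x (conj Wx xb)) (ltW cb)).
have [Oy yK Py] := WN y Wy.
suff ec : e = c by exists y; rewrite -ec.
apply/eqP; rewrite eq_le ce andbT leNgt; apply/negP => {}ce.
have /(CB_derivative_rank T2 T3 _ ye yK cK coK) : (e <= e)%O by [].
move=> /(CB_derivative_lt T2 clK ce) Dy.
have [A [oA _ Ay AP Ae] AW] := peak_nbhs Py ye (open_nbhs_nbhs (conj oW Wy)).
have [z [zy Dz Az]] := Dy _ (open_nbhs_nbhs (conj oA Ay)).
have [f fe zf] := Ae z Az zy; have [_ zK _] := WN z (AW z Az).
have /(CB_derivative_rank T2 T3 c zf zK cK coK) cf := Dz.
have : (e <= f)%O.
  by apply: emin; split=> //; exists z; split=> //; exact: AW.
by rewrite leNgt fe.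
Qed.

End Peaks.

(** * Continuity on a subset in metric form *)

Section ContinuousOn.
Context {R : realType}.
Local Open Scope ring_scope.

Definition cont_on (X Y : metricType R) (A : set X) (f : X -> Y) :=
  forall x, A x -> forall e : R, 0 < e ->
    \forall z \near x, A z -> mdist (f x) (f z) < e.

Lemma within_cont_on (X Y : metricType R) (A : set X) (f : X -> Y) :
  {within A, continuous f} <-> cont_on A f.
Proof.
split=> [/subspace_continuousP fA x Ax e e0|fA].
  by have /metricType_numDomainType.cvgrPdist_lt/(_ e e0) := fA x Ax.
apply/subspace_continuousP => x Ax.
by apply/metricType_numDomainType.cvgrPdist_lt => e; exact: fA.
Qed.

Lemma cont_on_eq (X Y : metricType R) (A : set X) (f g : X -> Y) :
  (forall x, A x -> f x = g x) -> cont_on A f -> cont_on A g.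
Proof.
move=> fg fA x Ax e e0; apply: filterS (fA x Ax e e0) => z + Az.
by rewrite -!fg//; apply.
Qed.

Lemma cont_on_patch (X Y : metricType R) (A B : set X) (f g : X -> Y) :
  open A -> open B -> B `<=` ~` A -> cont_on A f -> cont_on B g ->
  cont_on (A `|` B) (patch g A f).
Proof.
move=> oA oB BA fA gB x + e e0; rewrite /patch => -[Ax|Bx].
  have xA := open_nbhs_nbhs (conj oA Ax).
  apply: filterS2 xA (fA x Ax e e0) => z Az fz _.
  by rewrite !mem_set//; exact: fz.
have xB := open_nbhs_nbhs (conj oB Bx).
apply: filterS2 xB (gB x Bx e e0) => z Bz gz _.
by rewrite !memNset; [exact: gz|exact: BA|exact: BA].
Qed.

Lemma mdist_almost_min (X : metricType R) (P : set X) (x : X) (e : R) :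
  P !=set0 -> 0 < e ->
  exists2 p, P p & forall q, P q -> mdist x p <= mdist x q + e.
Proof.
move=> P0 e0; have infD : has_inf (mdist x @` P).
  by split; [exact: image_nonempty|exists 0 => _ [q _ <-]; exact: mdist_ge0].
have [_ [p Pp <-] xp] := inf_adherent e0 infD.
exists p => // q Pq; apply: (le_trans (ltW xp)); rewrite lerD2r.
by apply: ge_inf; [exact: infD.2|exists q].
Qed.

End ContinuousOn.

(** * Partial homeomorphisms and the back-and-forth construction *)

Section PartialHomeo.
Context {R : realType}.
Local Open Scope ring_scope.

(** Both maps are total, but only their values on [dom] and [cod] matter; the carriers can then grow
    without a change of type. *)
Record pmap (X Y : Type) := PMap {
  dom : set X; cod : set Y; fwd : X -> Y; bwd : Y -> X }.

Definition pswap X Y (s : pmap X Y) := PMap (cod s) (dom s) (bwd s) (fwd s).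

Definition phomeo (X Y : metricType R) (s : pmap X Y) :=
  [/\ forall x, dom s x -> cod s (fwd s x) /\ bwd s (fwd s x) = x,
      forall y, cod s y -> dom s (bwd s y) /\ fwd s (bwd s y) = y,
      cont_on (dom s) (fwd s) & cont_on (cod s) (bwd s)].

Definition clopen_phomeo (X Y : metricType R) (U : set X) (V : set Y)
    (s : pmap X Y) :=
  [/\ phomeo s, [/\ open (dom s), closed (dom s) & dom s `<=` U] &
      [/\ open (cod s), closed (cod s) & cod s `<=` V]].

(* Both distances are compared with those to the whole of P and Q, up to e: the
   condition is symmetric in the two spaces, and it makes x and y close to p and
   h p as soon as they are close to P and Q. *)
Definition link (X Y : metricType R) (P : set X) (Q : set Y) (h : X -> Y)
    (e : R) (x : X) (y : Y) :=
  exists p, [/\ P p, forall p', P p' -> mdist x p <= mdist x p' + e &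
                     forall q, Q q -> mdist y (h p) <= mdist y q + e].

(** Only the points added to the domain are linked, so that the tolerance can shrink from stage to
    stage. *)
Definition pext (X Y : metricType R) (P : set X) (Q : set Y) (h : X -> Y)
    (e : R) (s t : pmap X Y) :=
  [/\ dom s `<=` dom t, cod s `<=` cod t,
      forall x, dom s x -> fwd t x = fwd s x,
      forall y, cod s y -> bwd t y = bwd s y &
      forall x, dom t x -> ~ dom s x -> link P Q h e x (fwd t x)].

(** Isolates what the back-and-forth needs from the ranks; the same construction then serves for
    kernels and for single peak points. *)
Definition local_match (X Y : metricType R) (U : set X) (V Q : set Y) :=
  forall x O q W, U x -> nbhs x O -> Q q -> nbhs q W ->
    exists s : pmap X Y, [/\ clopen_phomeo (O `&` U) (W `&` V) s & dom s x].

Lemma clopen_phomeo_swap (X Y : metricType R) (U : set X) (V : set Y) s :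
  clopen_phomeo U V s -> clopen_phomeo V U (pswap s).
Proof. by move=> [[? ? ? ?] ? ?]; split. Qed.

Lemma clopen_phomeoS (X Y : metricType R) (U U' : set X) (V V' : set Y) s :
  U `<=` U' -> V `<=` V' -> clopen_phomeo U V s -> clopen_phomeo U' V' s.
Proof.
move=> UU VV [ps [? ? sU] [? ? sV]].
by split=> //; split=> //; [exact: subset_trans UU|exact: subset_trans VV].
Qed.

Lemma pext_refl (X Y : metricType R) (P : set X) (Q : set Y) h e s :
  pext P Q h e s s.
Proof. by split. Qed.

Lemma pext_trans (X Y : metricType R) (P : set X) (Q : set Y) h e s t u :
  pext P Q h e s t -> pext P Q h e t u -> pext P Q h e s u.
Proof.
move=> [sD sC sf sb sl] [tD tC tf tb tl]; split.
- exact: subset_trans tD.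
- exact: subset_trans tC.
- by move=> x sx; rewrite tf ?sf//; exact: sD.
- by move=> y sy; rewrite tb ?sb//; exact: sC.
- move=> x ux sx; have [tx|tx] := EM (dom t x); last exact: tl.
  by rewrite tf//; exact: sl.
Qed.

(** A point new in the range comes from a point new in the domain, since an old one would be sent
    into [cod s]. The link through [p] becomes a link through [h p]. *)
Lemma pext_swap (X Y : metricType R) (P : set X) (Q : set Y) h h' e s t :
  (forall p, P p -> Q (h p) /\ h' (h p) = p) -> phomeo s -> phomeo t ->
  pext P Q h e s t -> pext Q P h' e (pswap s) (pswap t).
Proof.
move=> hP [pf _ _ _] [_ tb _ _] [sD sC sf sb sl]; split=> //= y ty sy.
have [tx txE] := tb _ ty; have [sx|sx] := EM (dom s (bwd t y)); last first.
  have [p [Pp xp yp]] := sl _ tx sx; have [Qp hK] := hP _ Pp.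
  by exists (h p); rewrite txE in yp; split=> //; rewrite hK.
by case: sy; rewrite -txE sf//; have [] := pf _ sx.
Qed.

Lemma phomeo_union (X Y : metricType R) (U : set X) (V : set Y) s r :
  clopen_phomeo U V s -> clopen_phomeo (U `\` dom s) (V `\` cod s) r ->
  clopen_phomeo U V (PMap (dom s `|` dom r) (cod s `|` cod r)
    (patch (fwd r) (dom s) (fwd s)) (patch (bwd r) (cod s) (bwd s))).
Proof.
move=> [[sf sb sfc sbc] [soA scA sA] [soB scB sB]].
move=> [[rf rb rfc rbc] [roA rcA rA] [roB rcB rB]].
split; last 2 first.
- by split; [exact: openU|exact: closedU|move=> x [/sA//|/rA[]]].
- by split; [exact: openU|exact: closedU|move=> x [/sB//|/rB[]]].
split=> /=.
- move=> x [sx|rx]; rewrite /patch.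
    have [By xE] := sf x sx.
    by rewrite (mem_set sx) (mem_set By); split => //; left.
  have [By xE] := rf x rx.
  by rewrite !memNset; [split=> //; right|have [] := rB _ By|have [] := rA _ rx].
- move=> x [sx|rx]; rewrite /patch.
    have [By xE] := sb x sx.
    by rewrite (mem_set sx) (mem_set By); split => //; left.
  have [By xE] := rb x rx.
  by rewrite !memNset; [split=> //; right|have [] := rA _ By|have [] := rB _ rx].
- by apply: cont_on_patch => // x /rA[].
- by apply: cont_on_patch => // x /rB[].
Qed.

Lemma pext_step (X Y : metricType R) (U P : set X) (V Q : set Y) h e s x :
  P !=set0 -> (forall p, P p -> Q (h p)) -> Q `<=` ~` V ->
  local_match U V Q -> clopen_phomeo U V s -> 0 < e -> U x ->
  exists t, [/\ clopen_phomeo U V t, pext P Q h e s t & dom t x].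
Proof.
move=> P0 hPQ QV UVQ ps e0 Ux.
have [sx|sx] := EM (dom s x); first by exists s; split=> //; exact: pext_refl.
(* The point [p] is nearest to [x] up to [e / 2]; passing from [x] to a point within [e / 4] costs
   [e / 4] twice, for a total tolerance [e]. *)
have e2 : 0 < e / 2 by lra.
have e4 : 0 < e / 4 by lra.
have [p Pp xp] := mdist_almost_min x P0 e2.
have [_ [_ cA sA] [_ cB sB]] := ps.
have xO : nbhs x ([set z | mdist x z < e / 4] `&` ~` dom s).
  apply: filterI; first exact: nbhs_mdist.
  by apply: open_nbhs_nbhs; split=> //; exact: closed_openC.
(* The closed set [cod s] lies in [V] and [h p] lies in [Q], so a neighbourhood of [h p] avoids
   it. *)
have qW : nbhs (h p) ([set w | mdist (h p) w < e] `&` ~` cod s).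
  apply: filterI; first exact: nbhs_mdist.
  apply: open_nbhs_nbhs; split; first exact: closed_openC.
  by move=> /sB; exact: QV (hPQ p Pp).
have [r [pr rx]] := UVQ x _ (h p) _ Ux xO (hPQ p Pp) qW.
have [[rf _ _ _] [_ _ rO] [_ _ rW]] := pr.
have pt : clopen_phomeo U V (PMap (dom s `|` dom r) (cod s `|` cod r)
    (patch (fwd r) (dom s) (fwd s)) (patch (bwd r) (cod s) (bwd s))).
  by apply: phomeo_union => //; apply: clopen_phomeoS pr => y [[_ ?] ?].
eexists; split; [exact: pt| |by right].
split=> /=.
- by move=> y; left.
- by move=> y; left.
- by move=> y sy; rewrite /patch (mem_set sy).
- by move=> y sy; rewrite /patch (mem_set sy).
move=> z [//|rz] sz; rewrite /patch (memNset sz).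
have [[/= xz _] _] := rO _ rz.
have [Bz _] := rf z rz; have [[/= yz _] _] := rW _ Bz.
exists p; split=> // [p' Pp'|q Qq]; last first.
  by rewrite metric_sym; have := mdist_ge0 (fwd r z) q; lra.
have := xp p' Pp'; have := metric_triangle z x p.
by have := metric_triangle x z p'; rewrite (metric_sym z x); lra.
Qed.

(** Stage [n] first absorbs the point of [U] with index [n], if there is one, and then the point of
    [V] with index [n], by the same step applied to the swapped map. *)
Lemma pext_sequence (X Y : metricType R) (U P : set X) (V Q : set Y) h h' :
  countable U -> countable V -> P !=set0 ->
  P `<=` ~` U -> Q `<=` ~` V ->
  (forall p, P p -> Q (h p) /\ h' (h p) = p) ->
  (forall q, Q q -> P (h' q) /\ h (h' q) = q) ->
  local_match U V Q -> local_match V U P ->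
  exists s : nat -> pmap X Y,
    [/\ forall n, clopen_phomeo U V (s n),
        forall n, pext P Q h n.+1%:R^-1 (s n) (s n.+1),
        forall x, U x -> exists n, dom (s n) x &
        forall y, V y -> exists n, cod (s n) y].
Proof.
move=> /countable_injP[cU cUi] /countable_injP[cV cVi] P0 PU QV hP hQ UVQ VUP.
have Q0 : Q !=set0 by have [p Pp] := P0; exists (h p); have [] := hP p Pp.
have hP1 p : P p -> Q (h p) by move=> /hP[].
have hQ1 q : Q q -> P (h' q) by move=> /hQ[].
(* The invariant is a premise inside the existential, so that [choice] applies to all pairs. *)
have step (ns : nat * pmap X Y) : exists t, clopen_phomeo U V ns.2 ->
    [/\ clopen_phomeo U V t, pext P Q h ns.1.+1%:R^-1 ns.2 t,
      forall x, U x -> cU x = ns.1 -> dom t x &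
      forall y, V y -> cV y = ns.1 -> cod t y].
  case: ns => n s /=; have [ps|nps] := EM (clopen_phomeo U V s); last by exists s.
  have n0 : 0 < n.+1%:R^-1 :> R by rewrite invr_gt0 ltr0n.
  have [t1 [pt1 st1 t1x]] : exists t, [/\ clopen_phomeo U V t,
      pext P Q h n.+1%:R^-1 s t & forall x, U x -> cU x = n -> dom t x].
    have [[x [Ux xn]]|nx] := EM (exists x, U x /\ cU x = n); last first.
      exists s; split => // [|x Ux xn]; first exact: pext_refl.
      by case: nx; exists x.
    have [t [pt st tx]] := pext_step P0 hP1 QV UVQ ps n0 Ux.
    exists t; split=> // x' Ux' x'n.
    by rewrite (cUi x' x) ?inE// x'n.
  have [t2 [pt2 st2 t2y]] : exists t, [/\ clopen_phomeo U V t,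
      pext P Q h n.+1%:R^-1 t1 t & forall y, V y -> cV y = n -> cod t y].
    have [[y [Vy yn]]|ny] := EM (exists y, V y /\ cV y = n); last first.
      exists t1; split => // [|y Vy yn]; first exact: pext_refl.
      by case: ny; exists y.
    have [t [pt st ty]] := pext_step Q0 hQ1 PU VUP (clopen_phomeo_swap pt1) n0 Vy.
    exists (pswap t); split=> [||y' Vy' y'n]; first exact: clopen_phomeo_swap.
      have -> : t1 = pswap (pswap t1) by case: (t1).
      by apply: pext_swap st => //; [case: (clopen_phomeo_swap pt1)|case: pt].
    by rewrite /= (cVi y' y) ?inE// y'n.
  exists t2 => _; split=> //; first exact: pext_trans st2.
  by move=> x Ux xn; have [+ _ _ _ _] := st2; apply; exact: t1x.
have [F FP] := choice step.
(* The construction starts from the empty partial map; [h] and [h'] are mere default values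
   there. *)
pose s := fix s n := if n is m.+1 then F (m, s m) else PMap set0 set0 h h'.
have ps n : clopen_phomeo U V (s n).
  elim: n => [|n IH]; last by have [] := FP (n, s n) IH.
  by split; split=> //=; [exact: open0|exact: closed0|exact: open0|exact: closed0].
exists s; split=> // [n|x Ux|y Vy].
- by have [] := FP (n, s n) (ps n).
- by exists (cU x).+1; have [_ _ + _] := FP (cU x, s (cU x)) (ps _); exact.
- by exists (cV y).+1; have [_ _ _ +] := FP (cV y, s (cV y)) (ps _); exact.
Qed.

(** Near a point of [U], the map is continuous on an open stage [A n]. Near a point of [P], a point
    [z] of [U] lies outside [A n], so [F z] lies outside [B n]; compactness puts [F z] near [Q], and
    the link puts it near [F p] for some [p] near [z]. *)
Lemma limit_cont (X Y : metricType R) (U P : set X) (V Q : set Y)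
    (A : nat -> set X) (B : nat -> set Y) (F : X -> Y) (eps : nat -> R) :
  (forall e, 0 < e -> \forall n \near \oo, eps n < e) ->
  compact (V `|` Q) -> P `<=` ~` U ->
  (forall n, [/\ open (A n), closed (A n) & A n `<=` U]) ->
  (forall x, U x -> exists n, A n x) ->
  (forall n, open (B n)) -> {homo B : m n / (m <= n)%N >-> m `<=` n} ->
  (forall y, V y -> exists n, B n y) ->
  (forall n, cont_on (A n) F) -> cont_on P F ->
  (forall n x, U x -> ~ A n x ->
    [/\ V (F x), ~ B n (F x) & link P Q F (eps n) x (F x)]) ->
  cont_on (U `|` P) F.
Proof.
move=> eps0 coK PU AP UA oB Bmono VB FA FP Flink x + e e0 => -[Ux|Px].
  have [n Anx] := UA x Ux; have [oA _ _] := AP n.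
  apply: filterS2 (open_nbhs_nbhs (conj oA Anx)) (FA n x Anx e e0) => z Az + _.
  exact.
have e4 : 0 < e / 4 by lra.
(* The increasing open sets [B n] and the balls around points of [Q] cover a compact set, so one
   [B n] suffices. *)
have Bcover : \forall n \near \oo, V `|` Q `<=`
    [set y | B n y \/ exists2 q, Q q & mdist y q < e / 4].
  apply: (compact_near_coveringP _).1 coK _ _ _ _ _ => y [Vy|Qy].
    have [m Bmy] := VB y Vy.
    exists (B m, [set n | (m <= n)%N]) => /=.
      split; first exact: open_nbhs_nbhs.
      by exists m.
    by move=> [z n] /= [Bz mn]; left; exact: Bmono mn _ Bz.
  exists ([set z | mdist y z < e / 4], setT) => /=.
    by split; [exact: nbhs_mdist|exact: filterT].
  by move=> [z n] /= [yz _]; right; exists y => //; rewrite metric_sym.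
(* A [z] within [r / 4] of [x] has its link [p] within [3r / 4] of [x]; on the image side three
   errors of at most [e / 4] add up. *)
have /nbhs_ballP[r /= r0 rP] := FP x Px _ e4.
have r4 : 0 < r / 4 by lra.
have [n [Bn nr ne]] : exists n, [/\ V `|` Q `<=`
    [set y | B n y \/ exists2 q, Q q & mdist y q < e / 4],
    eps n < r / 4 & eps n < e / 4].
  by near \oo => n; exists n; split; near: n => //; exact: eps0.
have [_ cA AU] := AP n.
have xA : nbhs x (~` A n).
  apply: open_nbhs_nbhs; split; first exact: closed_openC.
  by move=> /AU; exact: PU.
apply: filterS2 xA (nbhs_mdist x r4) => z Az /= xz [Uz|Pz]; last first.
  by apply: lt_trans (rP z _ Pz) _; [rewrite ballEmdist/=|]; lra.
have [Vz Bz [p [Pp zp Fzp]]] := Flink n z Uz Az.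
have [//|[q Qq zq]] := Bn _ (or_introl Vz).
have xp : mdist (F x) (F p) < e / 4.
  apply: rP => //; rewrite ballEmdist/=.
  have := zp x Px; have := metric_triangle x z p; rewrite (metric_sym z x); lra.
have := Fzp q Qq; have := metric_triangle (F x) (F p) (F z).
by rewrite (metric_sym (F p) (F z)); lra.
Unshelve. all: by end_near. Qed.

End PartialHomeo.

(** * The limit of the stages and the extension of a homeomorphism *)

Section Extension.
Context {R : realType}.
Local Open Scope ring_scope.

(** The index picked by [cid] is arbitrary; for an extending sequence of stages the value does not
    depend on it. *)
Definition glue (X Y : Type) (A : nat -> set X) (f : nat -> X -> Y)
    (h : X -> Y) (x : X) : Y :=
  if pselect (exists n, A n x) is left An then f (projT1 (cid An)) x else h x.

Lemma pext_le (X Y : metricType R) (P : set X) (Q : set Y) h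
    (eps : nat -> R) s :
  (forall n, pext P Q h (eps n) (s n) (s n.+1)) ->
  forall m n, (m <= n)%N ->
  [/\ dom (s m) `<=` dom (s n), cod (s m) `<=` cod (s n),
      forall x, dom (s m) x -> fwd (s n) x = fwd (s m) x &
      forall y, cod (s m) y -> bwd (s n) y = bwd (s m) y].
Proof.
move=> sE m n; elim: n => [|n IH]; first by rewrite leqn0 => /eqP->; split.
rewrite leq_eqVlt => /predU1P[->|/IH[mD mC mf mb]]; first by split.
have [nD nC nf nb _] := sE n; split.
- exact: subset_trans nD.
- exact: subset_trans nC.
- by move=> x mx; rewrite nf ?mf//; exact: mD.
- by move=> y my; rewrite nb ?mb//; exact: mC.
Qed.

Lemma glue_limit (X Y : metricType R) (U P : set X) (V Q : set Y) h s :
  compact (V `|` Q) -> P `<=` ~` U -> cont_on P h ->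
  (forall n, clopen_phomeo U V (s n)) ->
  (forall n, pext P Q h n.+1%:R^-1 (s n) (s n.+1)) ->
  (forall x, U x -> exists n, dom (s n) x) ->
  (forall y, V y -> exists n, cod (s n) y) ->
  let F := glue (fun n => dom (s n)) (fun n => fwd (s n)) h in
  [/\ forall n x, dom (s n) x -> F x = fwd (s n) x,
      forall p, P p -> F p = h p & cont_on (U `|` P) F].
Proof.
move=> coK PU hc sH sE sU sV F.
have sle := pext_le sE.
have FE n x : dom (s n) x -> F x = fwd (s n) x.
  rewrite /F /glue => nx; case: pselect => [An|[]]; last by exists n.
  case: cid => m /= mx; have [mn|/ltnW nm] := leqP m n.
    by have [_ _ + _] := sle m n mn => ->.
  by have [_ _ + _] := sle n m nm => ->.
have FP p : P p -> F p = h p.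
  rewrite /F /glue => Pp; case: pselect => // -[n np].
  by have [_ [_ _ /(_ p np) Up] _] := sH n; case: (PU p).
split=> //; pose eps n : R := n.+1%:R^-1.
apply: (@limit_cont _ _ _ U P V Q (fun n => dom (s n))
  (fun n => cod (s n)) F eps).
- by move=> e e0; exact: (near_infty_natSinv_lt (PosNum e0)).
- exact: coK.
- exact: PU.
- by move=> n; have [] := sH n.
- exact: sU.
- by move=> n; have [_ _ []] := sH n.
- by move=> m n mn; have [] := sle m n mn.
- exact: sV.
- move=> n; have [[_ _ fc _] _ _] := sH n.
  by apply: cont_on_eq fc => x nx; rewrite (FE n).
- by apply: cont_on_eq hc => p Pp; rewrite FP.
move=> n x Ux nx; have [m mx] := sU x Ux.
have nm : (n <= m)%N.
  by rewrite leqNgt; apply/negP => /ltnW mn; have [/(_ x mx)] := sle m n mn.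
have [[sf _ _ _] _ [_ _ sB]] := sH m; have [Cx xE] := sf x mx.
rewrite (FE m)//; split; first exact: sB.
  move=> nC; apply: nx; rewrite -xE; have [_ _ _ ->//] := sle n m nm.
  by have [[_ sb _ _] _ _] := sH n; have [] := sb _ nC.
rewrite -(FE m)//; rewrite -(subnKC nm) in mx; clear Cx xE.
(* The induction finds the stage [n + k] at which [x] enters the domain; the tolerance there is at
   most [1 / (n + 1)]. *)
elim: (m - n)%N mx => [|k IH]; first by rewrite addn0.
rewrite addnS => kx; have [/IH//|nkx] := EM (dom (s (n + k)%N) x).
have [_ _ _ _ /(_ x kx nkx)] := sE (n + k)%N.
rewrite -FE// => -[p [Pp xp Fp]]; exists p; rewrite (FP p)//.
have nk : (n + k).+1%:R^-1 <= n.+1%:R^-1 :> R.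
  by rewrite lef_pV2 ?posrE ?ltr0n// ler_nat ltnS leq_addr.
split=> // [p' /xp xp'|q /Fp Fq].
  by apply: le_trans xp' _; rewrite lerD2l.
by apply: le_trans Fq _; rewrite lerD2l.
Qed.

(** The limits of the stages and of the swapped stages are continuous, and mutually inverse because
    each stage is. *)
Lemma homeo_extension (X Y : metricType R) (U P : set X) (V Q : set Y) h h' :
  countable U -> countable V -> P !=set0 -> P `<=` ~` U -> Q `<=` ~` V ->
  compact (U `|` P) -> compact (V `|` Q) ->
  phomeo (PMap P Q h h') -> local_match U V Q -> local_match V U P ->
  exists f g, phomeo (PMap (U `|` P) (V `|` Q) f g) /\ forall p, P p -> f p = h p.
Proof.
move=> cU cV P0 PU QV coX coY [hP hQ hc hc'] UVQ VUP.
have [s [sH sE sU sV]] := pext_sequence cU cV P0 PU QV hP hQ UVQ VUP.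
have [FE FP Fc] := glue_limit coY PU hc sH sE sU sV.
have sH' n : clopen_phomeo V U (pswap (s n)) by exact: clopen_phomeo_swap.
have sE' n : pext Q P h' n.+1%:R^-1 (pswap (s n)) (pswap (s n.+1)).
  by apply: pext_swap (sE n) => //; [case: (sH n)|case: (sH n.+1)].
have [GE GQ Gc] := glue_limit coX QV hc' sH' sE' sV sU.
set F := glue _ _ h in FE FP Fc; set G := glue _ _ h' in GE GQ Gc.
exists F, G; split=> //; split=> //=.
- move=> x [Ux|Px]; last first.
    by have [Qx xE] := hP x Px; rewrite FP// GQ//; split=> //; right.
  have [n nx] := sU x Ux; have [[sf _ _ _] _ [_ _ sB]] := sH n.
  have [Cx xE] := sf x nx.
  by rewrite (FE n)// (GE n)//; split=> //; left; exact: sB.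
- move=> y [Vy|Qy]; last first.
    by have [Py yE] := hQ y Qy; rewrite GQ// FP//; split=> //; right.
  have [n ny] := sV y Vy; have [[_ sb _ _] [_ _ sA] _] := sH n.
  have [Dy yE] := sb y ny.
  by rewrite (GE n)// (FE n)//; split=> //; left; exact: sA.
Qed.

End Extension.

(** * Peaks of equal rank are homeomorphic *)

Section PeakClassification.
Context {d : Order.disp_t} {alpha : wellOrderType d} {R : realType}.

Definition ranked (X : metricType R) (P : set X) :=
  [/\ compact [set: X], closed P, countable (~` P) &
      forall x, ~ P x -> exists b : alpha, CB_point_eq x b].

Definition peaks_homeo (X Y : metricType R) (P : set X) (Q : set Y) (b : alpha) :=
  forall x y A B, CB_point_eq x b -> CB_point_eq y b ->
    peak P x b A -> peak Q y b B -> exists f g, phomeo (PMap A B f g).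

Lemma peaks_homeo_sym (X Y : metricType R) (P : set X) (Q : set Y) b :
  peaks_homeo P Q b -> peaks_homeo Q P b.
Proof.
move=> PQ x y A B xb yb Ax By; have [f [g [? ? ? ?]]] := PQ _ _ _ _ yb xb By Ax.
by exists g, f; split.
Qed.

(** Small peaks of the same rank around [x] and around a partner [y] near [q] are matched. The
    target set [S] is separate from [Q]: it is the kernel in the theorem and a single point in the
    induction. *)
Lemma local_match_peaks (X Y : metricType R) (P U : set X) (Q V S : set Y) :
  ranked P -> ranked Q -> open U -> open V -> U `<=` ~` P -> V `<=` ~` Q ->
  (forall x b, U x -> CB_point_eq x b -> peaks_homeo P Q b /\
    forall q W, S q -> nbhs q W ->
      exists y, [/\ W y, V y & CB_point_eq y b]) ->
  local_match U V S.
Proof.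
move=> [_ clP cP Prk] [_ clQ cQ Qrk] oU oV UP VQ UVS x O q W Ux xO Sq qW.
have Px := UP _ Ux; have [b xb] := Prk x Px.
have [PQb Sb] := UVS x b Ux xb.
have xOU : nbhs x (O `&` U) by apply: filterI => //; exact: open_nbhs_nbhs.
have [A Apeak AO] := peak_nbhs clP cP Prk Px xb xOU.
have [y [Wy Vy yb]] := Sb q _ Sq (open_nbhs_nbhs
  (conj (@open_interior _ W) (nbhs_singleton (nbhs_interior qW)))).
have yWV : nbhs y (W `&` V) by apply: filterI => //; exact: open_nbhs_nbhs.
have [B Bpeak BW] := peak_nbhs clQ cQ Qrk (VQ _ Vy) yb yWV.
have [f [g fg]] := PQb _ _ _ _ xb yb Apeak Bpeak.
have [oA cA Ax _ _] := Apeak; have [oB cB _ _ _] := Bpeak.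
by exists (PMap A B f g).
Qed.

Let T2 (X : metricType R) : hausdorff_space X := @metric_hausdorff _ X.
Let T3 (X : metricType R) : @regular_space X := @uniform_regular X.

Lemma open_setD1 (X : metricType R) (A : set X) x : open A -> open (A `\ x).
Proof.
move=> oA; apply: openI => //; apply: closed_openC.
exact: accessible_closed_set1 (hausdorff_accessible (@T2 X)) x.
Qed.

Lemma local_match_peak (X Y : metricType R) (P : set X) (Q : set Y) b x y A B :
  ranked P -> ranked Q -> (forall c, (c < b)%O -> peaks_homeo P Q c) ->
  CB_point_eq y b -> peak P x b A -> peak Q y b B ->
  local_match (A `\ x) (B `\ y) [set y].
Proof.
move=> rP rQ IH yb [oA cA Ax AP Alt] [oB cB By BQ Blt].
apply: (local_match_peaks rP rQ).
- exact: open_setD1.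
- exact: open_setD1.
- by move=> z [/AP].
- by move=> z [/BQ].
move=> z c [Az /eqP zx] zc.
have [c' c'b zc'] := Alt z Az zx.
have cb : (c < b)%O by rewrite (CB_point_eq_inj zc zc').
split=> [|_ W -> yW]; first exact: IH.
have yWB : nbhs y (W `&` B) by apply: filterI => //; exact: open_nbhs_nbhs.
have [_ clQ cQ Qrk] := rQ.
have [w [[Ww Bw] Qw wc]] := rank_below_dense clQ cQ Qrk (BQ _ By) yb cb yWB.
(* The partner [w] differs from [y], because ranks are unique and [c < b]. *)
exists w; split=> //; split=> // wy.
by move: cb; rewrite (CB_point_eq_inj yb (c := c)) ?ltxx// -wy.
Qed.

Lemma peaks_homeo_rank (X Y : metricType R) (P : set X) (Q : set Y) b :
  ranked P -> ranked Q -> peaks_homeo P Q b.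
Proof.
move=> rP rQ; elim: (lt_wf b) => {}b _ IH x y A B xb yb Ax By.
have xyAB := local_match_peak rP rQ IH yb Ax By.
have yxBA := local_match_peak rQ rP
  (fun c cb => peaks_homeo_sym (IH c cb)) xb By Ax.
have [_ cA xA AP _] := Ax; have [_ cB yB BQ _] := By.
have [coX _ cP _] := rP; have [coY _ cQ _] := rQ.
have AE : A `\ x `|` [set x] = A by rewrite setUC setDUK// => _ ->.
have BE : B `\ y `|` [set y] = B by rewrite setUC setDUK// => _ ->.
(* The singletons of [x] and [y] take the place of the kernels, with constant maps between them. *)
have [||||||||f [g [fg _]]] := @homeo_extension _ _ _ (A `\ x) [set x]
  (B `\ y) [set y] (fun=> y) (fun=> x) _ _ _ _ _ _ _ _ xyAB yxBA.
- by apply: sub_countable cP; apply: subset_card_le => z [/AP].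
- by apply: sub_countable cQ; apply: subset_card_le => z [/BQ].
- by exists x.
- by move=> z -> [_]; apply.
- by move=> z -> [_]; apply.
- by rewrite AE; apply: subclosed_compact coX _.
- by rewrite BE; apply: subclosed_compact coY _.
- split=> //= z -> e e0; apply: nearW => w _; rewrite mdistxx//.
by exists f, g; rewrite AE BE in fg.
Qed.

End PeakClassification.

(* If no perfect set had a countable complement, [get] would return its junk value
   set0; then X would be locally countable, hence countable. *)
Lemma perfect_kernel_closed_cocountable (X : topologicalType) :
  compact [set: X] -> ~ countable [set: X] ->
  (forall x, ~ perfect_kernel X x -> exists2 K, nbhs x K & countable K) ->
  closed (perfect_kernel X) /\ countable (~` perfect_kernel X).
Proof.
rewrite /perfect_kernel => coX ncX.
case: xgetP => [P _ [[clP _] cP] _|_ loc]; first by split.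
case: ncX.
have {}loc (x : X) : exists K : set X, nbhs x K /\ countable K.
  by have [|K xK cK] := loc x; [case|exists K].
pose F := filter_from [set C : set X | countable C] (fun C => [set D | C `<=` D]).
have FF : Filter F.
  apply: filter_from_filter; first by exists set0; exact: countable0.
  move=> C D cC cD; exists (C `|` D); last by move=> E; rewrite /= subUset.
  by rewrite -bigcup2E; apply: bigcup_countable => // -[|[|]].
have [x _|C cC /(_ C (@subset_refl _ C)) TC] :=
  (compact_near_coveringP _).1 coX (set X) F (fun D x => D x) FF.
  have [K [xK cK]] := loc x; exists (K, [set D | K `<=` D]) => /=.
    by split=> //; exists K.
  by move=> [y D] /= [Ky KD]; exact: KD.
by apply: sub_countable cC; exact: subset_card_le.
Qed.

(** * Extension from the perfect kernels to the whole spaces *)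

Theorem corollary5p3 (d : Order.disp_t) (alpha : wellOrderType d)
    (alpha_countable : countable [set: alpha])
    (R : realType) (X1 X2 : metricType R)
    (X1_compact : compact [set: X1]) (X1_uncountable : ~ countable [set: X1])
    (X2_compact : compact [set: X2]) (X2_uncountable : ~ countable [set: X2])
    (a1 : forall x : X1, ~ perfect_kernel X1 x ->
      exists beta : alpha, CB_point_eq x beta)
    (a2 : forall x : X2, ~ perfect_kernel X2 x ->
      exists beta : alpha, CB_point_eq x beta)
    (b1 : forall beta : alpha, perfect_kernel X1 `<=`
      closure [set x : X1 | ~ perfect_kernel X1 x /\ CB_point_eq x beta])
    (b2 : forall beta : alpha, perfect_kernel X2 `<=`
      closure [set x : X2 | ~ perfect_kernel X2 x /\ CB_point_eq x beta])
    (h : X1 -> X2)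
    (h_homeo : homeomorphism (perfect_kernel X1) (perfect_kernel X2) h) :
  exists hbar : X1 -> X2, homeomorphism [set: X1] [set: X2] hbar /\
    forall x : X1, perfect_kernel X1 x -> hbar x = h x.
Proof.
have kernel (X : metricType R) : compact [set: X] -> ~ countable [set: X] ->
    (forall x : X, ~ perfect_kernel X x ->
      exists beta : alpha, CB_point_eq x beta) ->
    ranked (alpha := alpha) (perfect_kernel X).
  move=> coX ncX rkX.
  have [x /rkX[b [[K [xK cK _] _] _]]|clP cP] :=
    @perfect_kernel_closed_cocountable X coX ncX; first by exists K.
  by split.
have r1 := kernel _ X1_compact X1_uncountable a1.
have r2 := kernel _ X2_compact X2_uncountable a2.
have [_ cl1 c1 _] := r1; have [_ cl2 c2 _] := r2.
have [[hP _ hQ] hc [g gK gc]] := h_homeo.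
have kerT (X : metricType R) :
    ~` perfect_kernel X `|` perfect_kernel X = [set: X] by rewrite setvU.
have matching (X Y : metricType R) :
    ranked (alpha := alpha) (perfect_kernel X) ->
    ranked (alpha := alpha) (perfect_kernel Y) ->
    (forall b : alpha, perfect_kernel Y `<=`
      closure [set y | ~ perfect_kernel Y y /\ CB_point_eq y b]) ->
    local_match (~` perfect_kernel X) (~` perfect_kernel Y) (perfect_kernel Y).
  move=> rX rY dY; have [_ clX _ _] := rX; have [_ clY _ _] := rY.
  apply: (local_match_peaks rX rY) => //; try exact: closed_openC.
  (* The rank [b] of [x] is an element of [alpha], so condition (b) supplies points of rank [b] near
     every [q] of the kernel. *)
  move=> x b _ _; split=> [|q W Yq qW]; first exact: peaks_homeo_rank.
  by have [y [[Yy yb] Wy]] := dY b q Yq W qW; exists y.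
have [||||||||f [f' [[fP fQ fc f'c] fh]]] := @homeo_extension _ X1 X2
  (~` perfect_kernel X1) (perfect_kernel X1)
  (~` perfect_kernel X2) (perfect_kernel X2) h g _ _ _ _ _ _ _ _
  (matching _ _ r1 r2 b2) (matching _ _ r2 r1 b1) => //.
(* With an empty kernel the whole space would be its countable complement. *)
- apply: contrapT => /nonemptyPn P0; apply: X1_uncountable.
  by rewrite -(kerT X1) P0 setU0 -P0.
- by rewrite setCK.
- by rewrite setCK.
- by rewrite kerT.
- by rewrite kerT.
- split=> /=.
  + by move=> x Px; split; [exact: hP|exact: gK].
  (* [g] is given only as a left inverse; surjectivity of [h] makes it two-sided. *)
  + by move=> y /hQ[x Px <-]; rewrite gK.
  + exact/within_cont_on.
  + exact/within_cont_on.
rewrite !kerT in fP fQ fc f'c.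
exists f; split=> //; split.
- split=> //.
  + move=> x y _ _ fxy; have /= <- := (fP x I).2; rewrite fxy.
    exact: (fP y I).2.
  + by move=> y _; exists (f' y) => //; have [] := fQ y I.
- exact/within_cont_on.
- by exists f'; [move=> x _; have [] := fP x I|exact/within_cont_on].
Qed.
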